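(* For every $\delta \in (0,1/2)$ there exist a growth function $\mathcal{F}$ and a constant $C$, both depending only on $\delta$, such that the following holds. Let $G$ be a finite abelian group and let $f: G\to \mathbb{C}$ be a $1$-bounded function. Then there exists a $1$-factor $\mathcal{B}$ of $G$ with complexity at most $C$ and growth $\mathcal{F}$ such that $$ \|f - f_{\mathcal{B}}\|_{U^2(G)} \leq \delta. $$
   Context: Let $G$ be a finite abelian group, written additively; $\mathbb{E}_{x\in S}$ denotes the average over a finite nonempty set $S$. A character is a homomorphism $\gamma: G\to\mathbb{R}/\mathbb{Z}$; $\widehat{G}$ is the group of characters; $e(y)=e^{2\pi i y}$. For $f:G\to\mathbb{C}$, $\widehat{f}(\gamma) = \mathbb{E}_{x\in G} f(x)e(-\gamma(x))$, $\|f\|_2^2=\mathbb{E}_{x\in G}|f(x)|^2$, $\|\widehat{f}\|_1=\sum_{\gamma\in\widehat{G}}|\widehat{f}(\gamma)|$, and $$\|f\|_{U^2(G)}^4 = \mathbb{E}_{x,h_1,h_2\in G} f(x)\overline{f(x+h_1)f(x+h_2)}f(x+h_1+h_2).$$ $f$ is $1$-bounded if $\|f\|_\infty\le 1$. A growth function is an increasing (in the weak sense) function $\mathcal{F}:\mathbb{R}_{>0}\to\mathbb{R}_{>0}$. A $1$-bounded $f:G\to\mathbb{C}$ is $1$-measurable with growth $\mathcal{F}$ if for every $M>0$ there is a $1$-bounded $f_{\mathrm{str}}:G\to\mathbb{C}$ with $\|\widehat{f_{\mathrm{str}}}\|_1\le \mathcal{F}(M)$ and $\|f-f_{\mathrm{str}}\|_2\le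 M^{-1}$. A subset $E\subset G$ is $1$-measurable with growth $\mathcal{F}$ if its indicator function $1_E$ is. A factor $\mathcal{B}$ of $G$ is a partition of $G$ into cells; it is a $1$-factor with complexity at most $M$ and growth $\mathcal{F}$ if it has at most $M$ cells and each cell is $1$-measurable with growth $\mathcal{F}$. For $f:G\to\mathbb{C}$, $f_{\mathcal{B}}(x) = \mathbb{E}_{y\in\mathcal{B}(x)} f(y)$, where $\mathcal{B}(x)$ is the cell of $\mathcal{B}$ containing $x$. *)

(* Defs.v *)
From HB Require Import structures.
From mathcomp Require Import all_boot all_order all_algebra.
From mathcomp Require Import generic_quotient ring_quotient.
From mathcomp Require Import boolp classical_sets cardinality fsbigop reals.
From mathcomp Require Import interval_inference trigo.
From mathcomp Require Import complex.

Set Implicit Arguments.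
Unset Strict Implicit.
Unset Printing Implicit Defensive.

Import Order.TTheory GRing.Theory Num.Theory.
Import ComplexField.Normc.

Local Open Scope ring_scope.
Local Open Scope complex_scope.
Local Open Scope quotient_scope.

Definition avg (K : fieldType) (T : finType) (S : {set T}) (g : T -> K) : K :=
  (\sum_(x in S) g x) / #|S|%:R.

Section Circle.
Variable R : realType.

Definition integers : pred R := fun t => t \is a Num.int.

Fact integers_zmod_closed : zmod_closed integers.
Proof.
split=> [|s t]; first by rewrite unfold_in /integers rpred0.
by rewrite [s \in _]unfold_in [t \in _]unfold_in [_ \in _]unfold_in; exact: rpredB.
Qed.

HB.instance Definition _ :=
  GRing.isZmodClosed.Build R integers integers_zmod_closed.

Definition integer_group := GRing.ZmodClosed.clone R integers _.

Definition RmodZ := Quotient.quot integer_group.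
HB.instance Definition _ := ZmodQuotient.on RmodZ.
HB.instance Definition _ := Choice.on RmodZ.

(* [expc t] is e^{2 pi i t} for a real number t. *)
Definition expc (t : R) : R[i] := cos (2 * pi * t) +i* sin (2 * pi * t).

(* The value does not depend on the representative, see [e_pi]. *)
Definition e (y : RmodZ) : R[i] := expc (repr y).

Lemma expcD s t : expc (s + t) = expc s * expc t.
Proof.
rewrite /expc mulrDr cosD sinD; apply/eqP; rewrite eq_complex /=.
by rewrite eqxx addrC eqxx.
Qed.

Lemma expc_int (t : R) : t \is a Num.int -> expc t = 1.
Proof.
have expc0 : expc 0 = 1 by rewrite /expc mulr0 cos0 sin0.
have expc_nat n : expc n%:R = 1.
  elim: n => [|n IH] //.
  by rewrite -natr1 expcD IH mul1r /expc mulr1 mulr_natl cos2pi sin2pi.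
move=> /intrP[[n|n] ->]; first exact: expc_nat.
have := expcD (- n.+1%:R) n.+1%:R.
by rewrite addNr expc0 expc_nat mulr1 NegzE mulrNz => <-.
Qed.

Lemma e_pi (t : R) : e (\pi_RmodZ t) = expc t.
Proof.
have int_repr : repr (\pi_RmodZ t) - t \is a Num.int.
  have := Quotient.idealrBE integer_group (repr (\pi_RmodZ t)) t.
  by rewrite reprK eqxx.
by rewrite /e -[repr _](subrK t) expcD expc_int// mul1r.
Qed.

End Circle.

Section Fourier.
Variables (R : realType) (G : finZmodType).
Implicit Types (f : G -> R[i]) (gamma : {ffun G -> RmodZ R}).

Definition characters : set {ffun G -> RmodZ R} :=
  [set gamma : {ffun G -> RmodZ R} | {morph gamma : x y / x + y}]%classic.

(* Hence the finitely supported sum in [fourier_norm1] runs over the whole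
   dual group. *)
Lemma finite_characters : finite_set characters.
Proof.
pose torsion (k : {ffun G -> 'I_#|G|}) : {ffun G -> RmodZ R} :=
  [ffun x => \pi_(RmodZ R) ((k x)%:R / #|G|%:R)].
apply: (sub_finite_set (B := (torsion @` setT)%classic)); last first.
  exact/finite_image/finite_finset.
move=> gamma gammaD.
have gamma0 : gamma 0 = 0.
  by apply: (addrI (gamma 0)); rewrite -gammaD !addr0.
have gammaMn x n : gamma (x *+ n) = gamma x *+ n.
  by elim: n => [|n IH]; rewrite ?mulr0n// !mulrS gammaD IH.
have G_gt0 : (0 < #|G|)%N by apply/card_gt0P; exists 0.
have n_neq0 : #|G|%:R != 0 :> R by rewrite pnatr_eq0 -lt0n.
have torsP x : exists k : 'I_#|G|, gamma x = \pi_(RmodZ R) (k%:R / #|G|%:R).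
  have xn0 : x *+ #|G| = 0.
    apply: (addIr (\sum_y y)); rewrite add0r -sumr_const -big_split /=.
    by rewrite [RHS](reindex_inj (addrI x)).
  have tn0 : repr (gamma x) *+ #|G| \is a Num.int.
    have := Quotient.idealrBE (integer_group R) (repr (gamma x) *+ #|G|) 0.
    rewrite subr0 => ->; apply/eqP.
    by rewrite raddfMn /= reprK raddf0 -gammaMn xn0.
  have /intrP[m Em] := tn0.
  have m_ge0 : (0 <= m %% #|G|)%Z by rewrite modz_ge0 // -lt0n.
  have m_lt : (`|(m %% #|G|)%Z| < #|G|)%N.
    by rewrite -ltz_nat gez0_abs // ltz_pmod.
  exists (Ordinal m_lt) => /=; apply/eqP.
  have Er : repr (gamma x) = m%:~R / #|G|%:R.
    by apply: (mulIf n_neq0); rewrite mulfVK // mulr_natr.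
  rewrite -[gamma x]reprK Er -Quotient.idealrBE natr_absz (ger0_norm m_ge0).
  rewrite -mulrBl {1}(divz_eq m #|G|) -rmorphB /= addrK rmorphM /=.
  by rewrite -pmulrn mulfK // unfold_in; exact: intr_int.
exists [ffun x => sval (cid (torsP x))] => //.
by apply/ffunP => x; rewrite !ffunE -(svalP (cid (torsP x))).
Qed.

Definition fourier f gamma : R[i] :=
  avg [set: G] (fun x => f x * e (- gamma x)).

Definition fourier_norm1 f : R :=
  \sum_(gamma \in characters) normc (fourier f gamma).

Definition norm2 f : R := Num.sqrt (avg [set: G] (fun x => normc (f x) ^+ 2)).

Definition U2_avg f : R[i] :=
  avg [set: G * G * G] (fun t => let: (x, h1, h2) := t in
    f x * ((f (x + h1) * f (x + h2))^*)%C * f (x + h1 + h2)).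

(* [U2_avg f] is a nonnegative real number, see [U2_norm_expr4]. *)
Definition U2_norm f : R := Num.sqrt (Num.sqrt (complex.Re (U2_avg f))).

Lemma U2_norm_expr4 f : ((U2_norm f) ^+ 4)%:C = U2_avg f.
Proof.
suff: 0 <= U2_avg f.
  case Eab: (U2_avg f) => [a b]; rewrite lecE /= => /andP[/eqP b0 a0].
  by rewrite /U2_norm Eab /= (exprM _ 2 2) !sqr_sqrtr ?sqrtr_ge0 // b0.
rewrite /U2_avg /avg divr_ge0 // (eq_bigl xpredT) => [|t]; last by rewrite finset.in_setT.
rewrite (eq_bigr (fun t => f t.1.1 * ((f (t.1.1 + t.1.2) * f (t.1.1 + t.2))^*)%C
    * f (t.1.1 + t.1.2 + t.2))) => [|[[x h1] h2] _ //].
rewrite -(pair_bigA _ (fun p h2 => f p.1 * ((f (p.1 + p.2) * f (p.1 + h2))^*)%C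
    * f (p.1 + p.2 + h2))) /=.
rewrite -(pair_bigA _ (fun x h1 => \sum_h2 f x * ((f (x + h1) * f (x + h2))^*)%C
    * f (x + h1 + h2))) /=.
rewrite exchange_big /=; apply: sumr_ge0 => h _.
pose g x := f x * ((f (x + h))^*)%C.
suff -> : \sum_x \sum_h2 f x * ((f (x + h) * f (x + h2))^*)%C * f (x + h + h2)
    = (\sum_x g x) * ((\sum_x g x)^*)%C.
  by rewrite mulcJ_ge0.
rewrite mulr_suml; apply: eq_bigr => x _.
rewrite rmorph_sum mulr_sumr [RHS](reindex_inj (addrI x)) /=.
apply: eq_bigr => y _; rewrite /g !rmorphM /= conjcK (addrAC x y h).
by rewrite !mulrA.
Qed.

Definition bounded1 f := forall x, normc (f x) <= 1.

Definition growth_function (F : {posnum R} -> {posnum R}) :=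
  {homo F : M N / M <= N}.

Definition measurable1 (F : {posnum R} -> {posnum R}) f :=
  bounded1 f /\
  forall M : {posnum R}, exists fstr : G -> R[i],
    [/\ bounded1 fstr,
        fourier_norm1 fstr <= (F M)%:num &
        norm2 (f \- fstr) <= M%:num^-1].

Definition set_measurable1 (F : {posnum R} -> {posnum R}) (E : {set G}) :=
  measurable1 F (fun x => (x \in E)%:R).

(* As in [finset], the blocks of a partition are nonempty. *)
Definition factor1 (M : R) (F : {posnum R} -> {posnum R}) (B : {set {set G}}) :=
  [/\ finset.partition B [set: G], #|B|%:R <= M &
      forall E, E \in B -> set_measurable1 F E].

Definition factor_avg (B : {set {set G}}) f : G -> R[i] :=
  fun x => avg (finset.pblock B x) f.

End Fourier.

(* Main.v *)
(* Energy increment, with the Wiener algebra norm |fhat|_1 replaced by an upper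
   bound that needs no Fourier inversion: [wiener K r] says that [r] is a sum of
   correlations [x |-> sum_y u(y) v(x + y)] with [sum u^2, sum v^2 <= K].  This
   class is closed under sums and products, and Bessel's inequality bounds
   |rhat|_1 by [K].
   If g = f - f_B has |g|_U2 > delta, then g correlates with its dual function,
   whose real and imaginary parts lie in this class with a bounded constant.  By
   averaging over thresholds, g correlates with a level set of one of these parts
   w, at a threshold t for which E |w - t|^(-1/2) is bounded.  Near such a regular
   threshold w spends little time, so the indicator of the level set is
   L2-approximated by iterates of s |-> (3 s - s^3) / 2 applied to w - t, which
   converge to the sign of w - t away from 0.  Hence the level set is measurable
   with a growth depending only on delta; refining B by it decreases
   |f - f_B|_2^2 by a fixed amount, so boundedly many refinements suffice. *)
Require Import Defs.
From mathcomp Require Import all_boot all_order all_algebra.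
From mathcomp Require Import reals interval_inference complex.
From mathcomp Require Import boolp classical_sets cardinality fsbigop.
From mathcomp Require Import generic_quotient ring_quotient trigo.
From mathcomp Require Import ring lra zify.

Set Implicit Arguments.
Unset Strict Implicit.
Unset Printing Implicit Defensive.

Import Order.TTheory GRing.Theory Num.Theory.
Import ComplexField.Normc.

Local Open Scope ring_scope.

(** * The algebra of sums of correlations *)

Section WienerAlgebra.
Variables (R : realType) (G : finZmodType).
Implicit Types (r s : G -> R) (K L : R).

(** The index type is left free so that a sum of two members is indexed by a disjoint union and a
    product by pairs together with a shift in [G]. *)
Definition wiener K r := exists (I : finType) (u v : I -> G -> R),
  [/\ forall x, r x = \sum_i \sum_y u i y * v i (x + y),
      \sum_i \sum_y u i y ^+ 2 <= K & \sum_i \sum_y v i y ^+ 2 <= K].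

Lemma natr_card_gt0 : 0 < #|G|%:R :> R.
Proof. by rewrite ltr0n; apply/card_gt0P; exists 0. Qed.

Lemma sum_const_G (c : R) : \sum_(x : G) c = #|G|%:R * c.
Proof. by rewrite sumr_const mulr_natl. Qed.

Lemma wiener_ext K r s : r =1 s -> wiener K r -> wiener K s.
Proof. by move=> rs [I [u [v [h hu hv]]]]; exists I, u, v; split=> // x; rewrite -rs. Qed.

Lemma wiener_le K L r : K <= L -> wiener K r -> wiener L r.
Proof.
by move=> KL [I [u [v [h hu hv]]]]; exists I, u, v; split=> //; exact: le_trans KL.
Qed.

Lemma normrM_le_sqr (a b : R) : `|a * b| <= (a ^+ 2 + b ^+ 2) / 2.
Proof.
rewrite normrM -(real_normK (num_real a)) -(real_normK (num_real b)).
by have := sqr_ge0 (`|a| - `|b|); lra.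
Qed.

(** Each term is at most the mean of the two squares, and the sum of the squares of [v] is unchanged
    by the translation by [x]. *)
Lemma wiener_abs K r x : wiener K r -> `|r x| <= K.
Proof.
case=> I [u [v [-> hu hv]]].
suff: `|\sum_i \sum_y u i y * v i (x + y)| <=
    (\sum_i \sum_y u i y ^+ 2 + \sum_i \sum_y v i y ^+ 2) / 2 by lra.
rewrite -big_split mulr_suml /=.
apply: le_trans (ler_norm_sum _ _ _) _; apply: ler_sum => i _.
rewrite [\sum_y v i y ^+ 2](reindex_inj (addrI x)) /= -big_split mulr_suml /=.
by apply: le_trans (ler_norm_sum _ _ _) _; apply: ler_sum => y _; exact: normrM_le_sqr.
Qed.

Lemma wienerD K L r s :
  wiener K r -> wiener L s -> wiener (K + L) (fun x => r x + s x).
Proof.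
move=> [I [u [v [hr hu hv]]]] [J [u' [v' [hs hu' hv']]]].
exists (I + J)%type,
  (fun k => match k with inl i => u i | inr j => u' j end),
  (fun k => match k with inl i => v i | inr j => v' j end).
by split=> [x||]; rewrite big_sumType /= ?hr ?hs // lerD.
Qed.

(** For fixed [y] the point [y + k.2] runs over all of [G] as the shift [k.2] does, so the two sums
    decouple. *)
Lemma sum_shift (I J : finType) (F : I -> G -> R) (H : J -> G -> R) :
  \sum_(k : I * J * G) \sum_y F k.1.1 y * H k.1.2 (y + k.2) =
  (\sum_i \sum_y F i y) * (\sum_j \sum_z H j z).
Proof.
rewrite -(pair_bigA _ (fun p h => \sum_y F p.1 y * H p.2 (y + h))) /=.
rewrite -(pair_bigA _ (fun i j => \sum_h \sum_y F i y * H j (y + h))) /=.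
rewrite mulr_suml; apply: eq_bigr => i _.
rewrite mulr_sumr; apply: eq_bigr => j _.
rewrite exchange_big mulr_suml /=; apply: eq_bigr => y _.
by rewrite mulr_sumr [RHS](reindex_inj (addrI y)).
Qed.

(* A product of convolutions [u * v] and [u' * v'] is the sum over all shifts
   [h] of the convolutions of [u (T_h u')] and [v (T_h v')]. *)
Lemma wienerM K L r s :
  wiener K r -> wiener L s -> wiener (K * L) (fun x => r x * s x).
Proof.
move=> [I [u [v [hr hu hv]]]] [J [u' [v' [hs hu' hv']]]].
have sq_ge0 (T : finType) (w : T -> G -> R) : 0 <= \sum_i \sum_y w i y ^+ 2.
  by apply: sumr_ge0 => i _; apply: sumr_ge0 => y _; exact: sqr_ge0.
exists (I * J * G)%type, (fun k y => u k.1.1 y * u' k.1.2 (y + k.2)),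
  (fun k y => v k.1.1 y * v' k.1.2 (y + k.2)); split=> [x||].
- rewrite hr hs -(sum_shift (fun i y => u i y * v i (x + y))
    (fun j y => u' j y * v' j (x + y))).
  apply: eq_bigr => k _; apply: eq_bigr => y _.
  by rewrite -(addrA x y); ring.
- under eq_bigr => k _ do under eq_bigr => y _ do rewrite exprMn.
  by rewrite (sum_shift (fun i y => u i y ^+ 2) (fun j y => u' j y ^+ 2)) ler_pM.
- under eq_bigr => k _ do under eq_bigr => y _ do rewrite exprMn.
  by rewrite (sum_shift (fun i y => v i y ^+ 2) (fun j y => v' j y ^+ 2)) ler_pM.
Qed.

Lemma wienerZ c K r : wiener K r -> wiener (`|c| * K) (fun x => c * r x).
Proof.
move=> [I [u [v [hr hu hv]]]].
have sqc : Num.sqrt `|c| ^+ 2 = `|c| by rewrite sqr_sqrtr.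
have sumZ (d : R) (w : I -> G -> R) :
    \sum_i \sum_y (d * w i y) ^+ 2 = d ^+ 2 * \sum_i \sum_y w i y ^+ 2.
  rewrite mulr_sumr; apply: eq_bigr => i _; rewrite mulr_sumr.
  by apply: eq_bigr => y _; rewrite exprMn.
(* The scalar is shared evenly between both factors, and its sign goes to [v]. *)
exists I, (fun i y => Num.sqrt `|c| * u i y),
  (fun i y => Num.sg c * Num.sqrt `|c| * v i y); split=> [x||].
- rewrite hr mulr_sumr; apply: eq_bigr => i _; rewrite mulr_sumr.
  apply: eq_bigr => y _; rewrite {1}[c]numEsg -{1}sqc; ring.
- by rewrite sumZ sqc ler_wpM2l.
- rewrite sumZ exprMn sqc sqr_sg; case: eqP => [->|_].
    by rewrite normr0 !(mul0r, mulr0).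
  by rewrite mul1r ler_wpM2l.
Qed.

Lemma wiener_cst c : wiener `|c| (fun=> c).
Proof.
have G0 := natr_card_gt0; have G1 : #|G|%:R != 0 :> R by rewrite gt_eqF.
have sq : Num.sqrt (#|G|%:R^-1 : R) ^+ 2 = #|G|%:R^-1.
  by rewrite sqr_sqrtr // invr_ge0 ltW.
suff w1 : wiener 1 (fun=> 1 : R).
  have := wienerZ c w1; rewrite mulr1; apply: wiener_ext => x.
  by rewrite mulr1.
(* One correlation of two constants, each with squares summing to 1. *)
exists unit, (fun _ _ => Num.sqrt #|G|%:R^-1), (fun _ _ => Num.sqrt #|G|%:R^-1).
by split=> [x||]; rewrite big_const card_unit /= addr0 -?expr2 sum_const_G sq mulfV.
Qed.

(** Moving a factor sqrt |G| from [v] to [u] balances them: each sum of squares then has |G| terms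
    of size at most [k ^+ 2 / #|G|]. *)
Lemma wiener_conv (k : R) (u v : G -> R) :
  (forall y, `|u y| <= k / #|G|%:R) -> (forall y, `|v y| <= k) ->
  wiener (k ^+ 2) (fun x => \sum_y u y * v (x + y)).
Proof.
move=> hu hv; have G0 := natr_card_gt0; have G1 : #|G|%:R != 0 :> R by rewrite gt_eqF.
have k0 : 0 <= k by exact: le_trans (hv 0).
have q0 : Num.sqrt #|G|%:R != 0 :> R by rewrite sqrtr_eq0 -ltNge.
have sq : Num.sqrt #|G|%:R ^+ 2 = #|G|%:R :> R by rewrite sqr_sqrtr // ltW.
have bnd (a b : R) : `|a| <= b -> a ^+ 2 <= b ^+ 2.
  move=> h; rewrite -(real_normK (num_real a)) ler_pXn2r ?nnegrE //.
  exact: le_trans h.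
exists unit, (fun _ y => Num.sqrt #|G|%:R * u y), (fun _ y => v y / Num.sqrt #|G|%:R).
split=> [x||]; rewrite big_const card_unit /= addr0.
- by apply: eq_bigr => y _; field.
- rewrite (@le_trans _ _ (\sum_(y : G) #|G|%:R * (k / #|G|%:R) ^+ 2)) //.
    by apply: ler_sum => y _; rewrite exprMn sq ler_wpM2l ?(ltW G0) ?bnd.
  by rewrite sum_const_G le_eqVlt; apply/orP; left; apply/eqP; field.
- rewrite (@le_trans _ _ (\sum_(y : G) k ^+ 2 / #|G|%:R)) //.
    by apply: ler_sum => y _; rewrite exprMn exprVn sq ler_wpM2r ?invr_ge0 ?(ltW G0) ?bnd.
  by rewrite sum_const_G le_eqVlt; apply/orP; left; apply/eqP; field.
Qed.

End WienerAlgebra.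

(** * Orthogonality of characters and Bessel's inequality *)

Section Bessel.
Variables (R : realType) (G : finZmodType).
Implicit Types (gamma : {ffun G -> RmodZ R}).
Local Notation "x ^*c" := (conjc x) (at level 2, format "x ^*c").

Local Arguments conjc : simpl never.

Lemma eD (x y : RmodZ R) : e (x + y) = e x * e y.
Proof. by rewrite -[x]reprK -[y]reprK -raddfD !e_pi expcD. Qed.

Lemma e0 : e (0 : RmodZ R) = 1.
Proof. by rewrite -(raddf0 (\pi_(RmodZ R)%qT)) e_pi expc_int ?rpred0. Qed.

Lemma eN (x : RmodZ R) : e (- x) = (e x)^*c.
Proof.
by rewrite -[x]reprK -raddfN !e_pi /expc mulrN cosN sinN.
Qed.

Lemma e_conj (x : RmodZ R) : e x * (e x)^*c = 1.
Proof. by rewrite -eN -eD subrr e0. Qed.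

(** The cosine is injective on [0, pi], which covers [t <= 1 / 2]; for larger [t] the same argument
    applied to [1 - t] would force [t = 1]. *)
Lemma expc_eq1 (t : R) : 0 <= t < 1 -> expc t = 1 -> t = 0.
Proof.
move=> /andP[t0 t1] [c1 _].
have pi0 := pi_gt0 R.
have [tle|tgt] := leP t (1 / 2).
  have := @cos_inj R (2 * pi * t) 0; rewrite !in_itv /= lexx cos0 c1 pi_ge0.
  move=> /(_ _ isT erefl) H; have {}H : 2 * pi * t = 0 by apply: H; nra.
  by apply/eqP; move/eqP: H; rewrite !mulf_eq0 (gt_eqF pi0) pnatr_eq0.
have := @cos_inj R (2 * pi * (1 - t)) 0; rewrite !in_itv /= lexx cos0 pi_ge0.
have -> : cos (2 * pi * (1 - t)) = 1.
  by rewrite mulrBr mulr1 cosB mulr_natl cos2pi sin2pi -mulr_natl c1; ring.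
move=> /(_ _ isT erefl) H; have {}H : 2 * pi * (1 - t) = 0 by apply: H; nra.
by move/eqP: H; rewrite !mulf_eq0 (gt_eqF pi0) pnatr_eq0 /= subr_eq0 => /eqP E; lra.
Qed.

Lemma e_eq1 (x : RmodZ R) : e x = 1 -> x = 0.
Proof.
rewrite -[x]reprK e_pi; set t := repr x => ht.
have ft : t - (Num.floor t)%:~R = 0.
  apply: expc_eq1.
    by rewrite subr_ge0 floor_le /= ltrBlDl; have := floorD1_gt t; rewrite intrD.
  by rewrite expcD ht mul1r expc_int // rpredN intr_int.
apply/eqP; rewrite -(raddf0 (\pi_(RmodZ R)%qT)) -(Quotient.idealrBE (integer_group R)) subr0.
by move/eqP: ft; rewrite subr_eq0 => /eqP ->; exact: intr_int.
Qed.

(** Translating the sum by a point [z] where the characters differ multiplies it by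
    [e (gamma z - gamma' z)], which is not 1. *)
Lemma characters_orthogonal gamma gamma' :
  characters gamma -> characters gamma' -> gamma != gamma' ->
  \sum_y e (gamma y) * (e (gamma' y))^*c = 0.
Proof.
move=> gD gD' neq.
have [z nz] : exists z, gamma z - gamma' z != 0.
  apply/existsP; apply: contraNT neq; rewrite negb_exists => /forallP h.
  apply/eqP/ffunP => z; apply/eqP; rewrite -subr_eq0.
  by have := h z; rewrite negbK.
set S := LHS; have : (e (gamma z - gamma' z) - 1) * S = 0.
  apply/eqP; rewrite mulrBl mul1r subr_eq0; apply/eqP.
  rewrite [RHS](reindex_inj (addrI z)) /= mulr_sumr; apply: eq_bigr => y _.
  rewrite gD gD' -!eN !opprD -!eD; congr e; rewrite addrACA. reflexivity.
move/eqP; rewrite mulf_eq0 => /orP[|/eqP //].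
by rewrite subr_eq0 => /eqP/e_eq1/eqP; rewrite (negPf nz).
Qed.

(** With [T] equal to |G| times the projection of [u] to the span of the conjugate characters, [uT]
    and [Tu] give the inner products of [u] and [T] as [A], and [TT] gives |G| [A] for that of [T]
    with itself. The claim is the nonnegativity of the squared norm of |G| [u] - [T]. *)
Lemma bessel (s : seq {ffun G -> RmodZ R}) (u : G -> R[i]) :
  uniq s -> (forall gamma, gamma \in s -> characters gamma) ->
  \sum_(gamma <- s) (\sum_y u y * e (gamma y)) * (\sum_y u y * e (gamma y))^*c
    <= #|G|%:R * \sum_y u y * (u y)^*c.
Proof.
move=> us hs; pose z gamma := \sum_y u y * e (gamma y).
set A := \sum_(gamma <- s) _.
pose T y := \sum_(gamma <- s) z gamma * (e (gamma y))^*c.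
have uT : \sum_y u y * (T y)^*c = A.
  rewrite /A; under eq_bigr => y _ do rewrite rmorph_sum mulr_sumr /=.
  rewrite exchange_big /=; apply: eq_bigr => g _.
  rewrite -/(z g) mulr_suml; apply: eq_bigr => y _.
  by rewrite rmorphM /= conjcK; ring.
have A_real : A^*c = A.
  rewrite /A rmorph_sum; apply: eq_bigr => g _.
  by rewrite rmorphM /= conjcK mulrC.
have Tu : \sum_y (u y)^*c * T y = A.
  rewrite -A_real -uT rmorph_sum; apply: eq_bigr => y _.
  by rewrite rmorphM /= conjcK.
have TT : \sum_y T y * (T y)^*c = #|G|%:R * A.
  rewrite /A mulr_sumr; under eq_bigr => y _ do rewrite mulr_suml.
  rewrite exchange_big /=; apply: eq_big_seq => g gs.
  under eq_bigr => y _ do rewrite rmorph_sum mulr_sumr /=.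
  rewrite exchange_big /= (bigD1_seq g gs us) /= [X in _ + X]big1_seq ?addr0 => [|g' /andP[neq gs']].
    rewrite -/(z g).
    under eq_bigr => y _.
      rewrite rmorphM /= conjcK.
      have -> : z g * (e (g y))^*c * ((z g)^*c * e (g y)) = z g * (z g)^*c.
        by rewrite mulrACA (mulrC (_^*c) (e _)) e_conj mulr1.
      over.
    by rewrite sumr_const mulr_natl.
  transitivity (z g * (z g')^*c * \sum_y e (g' y) * (e (g y))^*c).
    by rewrite mulr_sumr; apply: eq_bigr => y _; rewrite rmorphM /= conjcK; ring.
  by rewrite (characters_orthogonal (hs _ gs') (hs _ gs) neq) mulr0.
have G0 : 0 < #|G|%:R :> R[i] by rewrite ltr0n; apply/card_gt0P; exists 0.
rewrite -subr_ge0 -(pmulr_rge0 _ G0).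
have -> : #|G|%:R * (#|G|%:R * (\sum_y u y * (u y)^*c) - A) =
    \sum_y (#|G|%:R * u y - T y) * (#|G|%:R * u y - T y)^*c.
  transitivity (#|G|%:R ^+ 2 * (\sum_y u y * (u y)^*c) - #|G|%:R * (\sum_y u y * (T y)^*c)
     - #|G|%:R * (\sum_y (u y)^*c * T y) + \sum_y T y * (T y)^*c).
    by rewrite uT Tu TT; ring.
  rewrite !mulr_sumr -!sumrB -big_split /=; apply: eq_bigr => y _.
  by rewrite rmorphB rmorphM /= conjc_nat; ring.
by apply: sumr_ge0 => y _; exact: mulcJ_ge0.
Qed.

End Bessel.

(** * The Fourier norm of a sum of correlations *)

Section FourierWiener.
Variables (R : realType) (G : finZmodType).
Implicit Types (gamma : {ffun G -> RmodZ R}).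
Local Notation "x ^*c" := (conjc x) (at level 2, format "x ^*c").
Local Notation "x %:C" := (real_complex _ x).
Local Arguments conjc : simpl never.

Lemma sqr_normcE (z : R[i]) : (normc z ^+ 2)%:C = z * z^*c.
Proof. by rewrite rmorphXn -sqr_normc normc_def; case: z. Qed.

Lemma normcJE (z : R[i]) : normc (z^*c) = normc z.
Proof. by case: z => a b; rewrite /normc /conjc /= sqrrN. Qed.

Lemma normc_real (x : R) : normc (x%:C) = `|x|.
Proof. by rewrite /normc /= expr0n addr0 sqrtr_sqr. Qed.

Lemma normc_sum (I : Type) (s : seq I) (P : pred I) (F : I -> R[i]) :
  normc (\sum_(i <- s | P i) F i) <= \sum_(i <- s | P i) normc (F i).
Proof.
elim/big_ind2: _ => [|x a y b xa yb|//]; first by rewrite normc0.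
exact: le_trans (le_normcD _ _) (lerD xa yb).
Qed.

Lemma bessel_real (s : seq {ffun G -> RmodZ R}) (u : G -> R) :
  uniq s -> (forall gamma, gamma \in s -> characters gamma) ->
  \sum_(gamma <- s) normc (\sum_y (u y)%:C * e (gamma y)) ^+ 2
    <= #|G|%:R * \sum_y u y ^+ 2.
Proof.
move=> us hs; rewrite -lecR; have := bessel (fun y => (u y)%:C) us hs.
congr (_ <= _); first by rewrite rmorph_sum; apply: eq_bigr => g _ /=; rewrite -sqr_normcE.
rewrite rmorphM /= rmorph_nat rmorph_sum; congr (_ * _); apply: eq_bigr => y _.
by rewrite conjc_real -rmorphM.
Qed.

Lemma fourier_conv (I : finType) (u v : I -> G -> R) gamma : characters gamma ->
  fourier (fun x => (\sum_i \sum_y u i y * v i (x + y))%:C) gamma =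
  #|G|%:R^-1 * \sum_i (\sum_y (u i y)%:C * e (gamma y)) * (\sum_y (v i y)%:C * e (gamma y))^*c.
Proof.
move=> gD; rewrite /fourier /avg cardsT mulrC; congr (_ * _).
under eq_bigl do rewrite finset.in_setT.
under eq_bigr => x _ do rewrite rmorph_sum mulr_suml.
rewrite exchange_big; apply: eq_bigr => i _ /=.
under eq_bigr => x _ do rewrite rmorph_sum mulr_suml.
rewrite exchange_big mulr_suml; apply: eq_bigr => y _ /=.
(* With [x + y] as the variable of the second factor, [e (- gamma x)] is [e (gamma y)] times the
   conjugate of [e (gamma (x + y))]. *)
rewrite rmorph_sum mulr_sumr [RHS](reindex_inj (addIr y)); apply: eq_bigr => x _ /=.
rewrite !rmorphM /= conjc_real gD -eN opprD eD !eN; set a := e (gamma y).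
have : a * a^*c = 1 by exact: e_conj.
set b := (e (gamma x))^*c => ab.
transitivity ((u i y)%:C * (v i (x + y))%:C * b * (a * a^*c)); last by ring.
by rewrite ab mulr1.
Qed.

(** By [fourier_conv] and [normrM_le_sqr], the norm is at most the mean of two Bessel sums divided
    by |G|, and Bessel's inequality returns the factor |G|. *)
Lemma fourier_norm1_wiener (K : R) (r : G -> R) :
  wiener K r -> fourier_norm1 (fun x => (r x)%:C) <= K.
Proof.
move=> [I [u [v [hr hu hv]]]]; have G0 := natr_card_gt0 R G.
rewrite /fourier_norm1 (fsbig_finite _ _ (finite_characters R G)).
set s := (X in \sum_(i <- X) _).
have us : uniq s by exact: finmap.fset_uniq.
have hs gamma : gamma \in s -> characters gamma.
  by rewrite /s in_fset_set ?inE //; exact: finite_characters.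
pose U (w : I -> G -> R) gamma i := normc (\sum_y (w i y)%:C * e (gamma y)).
have Ub w : \sum_i \sum_y w i y ^+ 2 <= K ->
    \sum_(gamma <- s) \sum_i U w gamma i ^+ 2 <= #|G|%:R * K.
  move=> hw; rewrite exchange_big /=.
  apply: le_trans (_ : #|G|%:R * \sum_i \sum_y w i y ^+ 2 <= _).
    by rewrite mulr_sumr; apply: ler_sum => i _; exact: bessel_real.
  by rewrite ler_pM2l.
apply: (@le_trans _ _ (\sum_(gamma <- s) #|G|%:R^-1 *
    ((\sum_i U u gamma i ^+ 2 + \sum_i U v gamma i ^+ 2) / 2))).
  rewrite big_seq [leRHS]big_seq; apply: ler_sum => gamma /hs gD.
  have -> : (fun x => (r x)%:C) = (fun x => (\sum_i \sum_y u i y * v i (x + y))%:C).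
    by apply: funext => x; rewrite hr.
  rewrite fourier_conv // normcM normcV.
  have -> : normc (#|G|%:R : R[i]) = #|G|%:R.
    by rewrite -(rmorph_nat (real_complex R)) normc_real ger0_norm ?ltW.
  rewrite ler_pM2l ?invr_gt0 //; apply: le_trans (normc_sum _ _ _) _.
  rewrite -big_split mulr_suml; apply: ler_sum => i _ /=.
  rewrite normcM normcJE; apply: le_trans (ler_norm _) _; exact: normrM_le_sqr.
rewrite -mulr_sumr -mulr_suml big_split /= mulrC ler_pdivrMr //.
by have := Ub _ hu; have := Ub _ hv; lra.
Qed.

End FourierWiener.

(** * Polynomial approximation of the sign function *)

Section SignIteration.
Variable R : realType.
Implicit Types (s : R) (n : nat).

(** The Newton-Schulz iteration for the sign: an odd polynomial fixing -1, 0 and 1. *)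
Definition sign_step s : R := (3 * s - s ^+ 3) / 2.
Definition sign_iter n s : R := iter n sign_step s.

Lemma sign_iterN n s : sign_iter n (- s) = - sign_iter n s.
Proof.
elim: n => [|n IH] //=.
by rewrite /sign_iter /= -!/(sign_iter n _) IH /sign_step; field.
Qed.

(* [1 - sign_step t = (1 - t) (2 - t - t^2) / 2 <= (1 - t) (1 - s / 2)] for
   [s <= t <= 1], and Bernoulli's inequality. *)
Lemma sign_iter_pos n s : 0 < s <= 1 ->
  s <= sign_iter n s <= 1 /\ (1 - sign_iter n s) * (1 + n%:R * (s / 2)) <= 1.
Proof.
move=> /andP[s0 s1]; elim: n => [|n [/andP[]]].
  by rewrite /sign_iter /= mul0r; split; [rewrite lexx|lra].
rewrite /sign_iter iterS; set t := iter n sign_step s => st t1 IH.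
have n0 : 0 <= n%:R :> R by [].
have t0 : 0 < t by lra.
have step : 1 - sign_step t = (1 - t) * ((2 - t - t ^+ 2) / 2) by rewrite /sign_step; field.
have le1 : (2 - t - t ^+ 2) / 2 <= 1 - s / 2 by nra.
have ge0 : 0 <= (2 - t - t ^+ 2) / 2 by nra.
have mono : 1 - sign_step t <= (1 - t) * (1 - s / 2).
  by rewrite step ler_wpM2l // subr_ge0.
split; first by apply/andP; split; [nra|rewrite -subr_ge0 step mulr_ge0 // subr_ge0].
have p0 : 0 <= 1 + n.+1%:R * (s / 2) by rewrite addr_ge0 // mulr_ge0 //; lra.
apply: le_trans (ler_wpM2r p0 mono) _.
rewrite -mulrA; apply: le_trans IH; apply: ler_wpM2l; first by rewrite subr_ge0.
by rewrite -natr1; nra.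
Qed.

Lemma sign_iter_bound n s : `|s| <= 1 -> `|sign_iter n s| <= 1.
Proof.
wlog s0 : s / 0 <= s => [H|] s1.
  have [|sn] := leP 0 s; first by move/H; apply.
  by rewrite -normrN -sign_iterN H ?normrN // oppr_ge0 ltW.
move: s0; rewrite le_eqVlt => /orP[/eqP<-|s0].
  suff -> : sign_iter n 0 = 0 by rewrite normr0.
  by have := sign_iterN n 0; rewrite oppr0; lra.
rewrite (gtr0_norm s0) in s1.
have /(sign_iter_pos n)[/andP[h1 h2] _] : 0 < s <= 1 by rewrite s0.
by rewrite ger0_norm //; lra.
Qed.

(** By oddness [s > 0] may be assumed. With [t] the iterate, the error is at most 1 - t <= sqrt (1 -
    t), and [sign_iter_pos] bounds 1 - t by 2 / (n s). Taking the root weakens the bound to the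
    exponent -1/2, whose average over thresholds is bounded. *)
Lemma sign_iter_error n s : (0 < n)%N -> s != 0 -> `|s| <= 1 ->
  ((0 < s)%R%:R - (1 + sign_iter n s) / 2) ^+ 2 <=
  Num.sqrt (2 / n%:R) * (Num.sqrt `|s|)^-1.
Proof.
move=> n0; wlog s0 : s / 0 < s => [H sN0 s1|_].
  have /orP[sn|/H] : (s < 0) || (0 < s) by rewrite -neq_lt.
    have := H (- s); rewrite oppr_gt0 sn oppr_eq0 normrN sign_iterN => /(_ isT sN0 s1).
    by rewrite (lt_gtF sn) mulr1n mulr0n; congr (_ <= _); field.
  by apply.
rewrite s0 gtr0_norm // => s1; have /(sign_iter_pos n)[] : 0 < s <= 1 by rewrite s0.
set t := sign_iter n s => /andP[st t1] ht.
have nR : 0 < n%:R :> R by rewrite ltr0n.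
have t01 : 0 <= 1 - t <= 1 by apply/andP; split; lra.
have q0 : 0 <= 2 / n%:R :> R by rewrite divr_ge0.
rewrite -sqrtrV ?(ltW s0) // -sqrtrM //.
apply: (@le_trans _ _ (1 - t)); first by rewrite mulr1n; nra.
apply: (@le_trans _ _ (Num.sqrt (1 - t))).
  rewrite -[leLHS]ger0_norm; last by lra.
  by rewrite -sqrtr_sqr ler_sqrt; [nra|lra].
have ns : 0 < n%:R * s by rewrite mulr_gt0.
rewrite ler_sqrt ?mulr_ge0 ?invr_ge0 ?(ltW s0) // -mulrA -invfM ler_pdivlMr //.
by nra.
Qed.

Variable G : finZmodType.

Lemma wiener_sign_step K (r : G -> R) :
  wiener K r -> wiener ((3 * K + K ^+ 3) / 2) (fun x => sign_step (r x)).
Proof.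
move=> hr; have := wienerD (wienerZ (3 / 2) hr) (wienerZ (- (1 / 2)) (wienerM hr (wienerM hr hr))).
rewrite normrN !ger0_norm; [|lra..].
have -> : 3 / 2 * K + 1 / 2 * (K * (K * K)) = (3 * K + K ^+ 3) / 2 by field.
by apply: wiener_ext => x; rewrite /sign_step; field.
Qed.

(** [sign_step] with a plus sign, since bounds add up in the triangle inequality. *)
Definition sign_wiener n (K : R) := iter n (fun K => (3 * K + K ^+ 3) / 2) K.

Lemma wiener_sign_iter n K (r : G -> R) :
  wiener K r -> wiener (sign_wiener n K) (fun x => sign_iter n (r x)).
Proof. by move=> hr; elim: n => [|n IH] //; exact: wiener_sign_step. Qed.

Lemma sign_wiener_ge n K : 1 <= K -> K <= sign_wiener n K.
Proof.
move=> K1; elim: n => [|n] //; rewrite /sign_wiener iterS; set L := iter _ _ _.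
move=> KL; have : L <= L ^+ 3 by rewrite exprS ler_peMr ?exprn_ege1 //; lra.
by lra.
Qed.

Lemma sign_wiener_homo K : 1 <= K -> {homo sign_wiener^~ K : m n / (m <= n)%N >-> m <= n}.
Proof.
move=> K1 m n /subnK <-; rewrite /sign_wiener iterD -!/(sign_wiener _ _).
by apply: sign_wiener_ge; apply: le_trans K1 (sign_wiener_ge _ K1).
Qed.

End SignIteration.

(** * Approximation of indicators in the algebra *)

Section Approximable.
Variables (R : realType) (G : finZmodType).
Implicit Types (F : R -> R) (h : G -> R).

(** A real form of [measurable1], with [wiener] for the Fourier norm and a sum in place of the
    average. The range [0, 1] of [phi] keeps errors under control in products. *)
Definition approximable F h := forall M, 0 < M -> exists phi : G -> R,
  [/\ forall x, 0 <= phi x <= 1, wiener (F M) phi &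
      \sum_x (h x - phi x) ^+ 2 <= #|G|%:R / M ^+ 2].

Lemma approximable_ext F h h' : h =1 h' -> approximable F h -> approximable F h'.
Proof.
move=> hh H M M0; have [phi [p1 p2 p3]] := H M M0; exists phi; split=> //.
by under eq_bigr => x _ do rewrite -hh.
Qed.

Lemma approximable1 : approximable (fun=> 1) (fun=> 1).
Proof.
move=> M M0; exists (fun=> 1); split=> [x||]; first by rewrite ler01 lexx.
  by have := wiener_cst G (1 : R); rewrite normr1.
by rewrite big1 ?divr_ge0 ?exprn_ge0 ?(ltW M0) // => x _; rewrite subrr expr0n.
Qed.

Lemma approximableC F h :
  approximable F h -> approximable (fun M => 1 + F M) (fun x => 1 - h x).
Proof.
move=> H M M0; have [phi [p1 p2 p3]] := H M M0.
exists (fun x => 1 - phi x); split=> [x||].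
- by have := p1 x; lra.
- have := wienerD (wiener_cst G (1 : R)) (wienerZ (-1) p2).
  rewrite normrN normr1 mul1r; apply: wiener_ext => x; by rewrite mulN1r.
- apply: le_trans p3; apply: ler_sum => x _; rewrite le_eqVlt; apply/orP; left.
  by apply/eqP; ring.
Qed.

Lemma approximable_le F F' h : (forall M, 0 < M -> F M <= F' M) ->
  approximable F h -> approximable F' h.
Proof.
move=> FF H M M0; have [phi [p1 p2 p3]] := H M M0; exists phi; split=> //.
exact: wiener_le (FF _ M0) p2.
Qed.

(** The error splits as (h - p) h' + p (h' - q). Each part has L2 norm at most 1 / (2 M), which is
    why both factors are approximated at scale [2 * M]. *)
Lemma approximableM F F' h h' :
  (forall x, 0 <= h x <= 1) -> (forall x, 0 <= h' x <= 1) ->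
  approximable F h -> approximable F' h' ->
  approximable (fun M => F (2 * M) * F' (2 * M)) (fun x => h x * h' x).
Proof.
move=> h01 h01' H H' M M0; have M20 : 0 < 2 * M by lra.
have [p [p1 p2 p3]] := H _ M20; have [q [q1 q2 q3]] := H' _ M20.
exists (fun x => p x * q x); split=> [x||]; first by have := p1 x; have := q1 x; nra.
  exact: wienerM.
have le2 (a b : R) : (a + b) ^+ 2 <= 2 * a ^+ 2 + 2 * b ^+ 2.
  by have := sqr_ge0 (a - b); nra.
apply: (@le_trans _ _ (2 * \sum_x (h x - p x) ^+ 2 + 2 * \sum_x (h' x - q x) ^+ 2)).
  rewrite !mulr_sumr -big_split /=; apply: ler_sum => x _.
  have -> : h x * h' x - p x * q x = (h x - p x) * h' x + p x * (h' x - q x) by ring.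
  apply: le_trans (le2 _ _) _; rewrite !exprMn.
  have sq1 (a : R) : 0 <= a <= 1 -> a ^+ 2 <= 1 by move=> ?; nra.
  apply: lerD; rewrite ler_wpM2l //.
    by rewrite ler_piMr ?sqr_ge0 ?sq1.
  by rewrite ler_piMl ?sqr_ge0 ?sq1.
have E : #|G|%:R / (2 * M) ^+ 2 = (#|G|%:R / M ^+ 2) / 4 :> R.
  by field; rewrite gt_eqF.
by rewrite E in p3 q3; lra.
Qed.

(** The number n of iterations exceeds 2 A^2 M^4, so that A sqrt (2 / n) <= 1 / M^2. The start 2
    bounds the shifted function, and (1 + .) / 2 turns a sign into an indicator. *)
Definition level_growth (A M : R) : R :=
  (1 + sign_wiener (Num.truncn (2 * A ^+ 2 * M ^+ 4)).+1 2) / 2.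

Lemma level_approximable (A : R) (s : G -> R) : 0 < A ->
  wiener 2 s -> (forall x, `|s x| <= 1) -> (forall x, s x != 0) ->
  \sum_x (Num.sqrt `|s x|)^-1 <= A * #|G|%:R ->
  approximable (level_growth A) (fun x => (0 < s x)%R%:R).
Proof.
move=> A0 ws s1 s0 hA M M0; rewrite /level_growth; set n := (Num.truncn _).+1.
exists (fun x => (1 + sign_iter n (s x)) / 2); split=> [x||].
- by have := sign_iter_bound n (s1 x); rewrite ler_norml; lra.
- have := wienerZ 2^-1 (wienerD (wiener_cst G (1 : R)) (wiener_sign_iter n ws)).
  rewrite normr1 ger0_norm; last by lra.
  rewrite mulrC; apply: wiener_ext => x; exact: mulrC.
- apply: (@le_trans _ _ (\sum_x Num.sqrt (2 / n%:R) * (Num.sqrt `|s x|)^-1)).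
    by apply: ler_sum => x _; exact: sign_iter_error.
  rewrite -mulr_sumr; apply: le_trans (ler_wpM2l (sqrtr_ge0 _) hA) _.
  have AM : 0 < A * M ^+ 2 by rewrite mulr_gt0 ?exprn_gt0.
  have G0 := natr_card_gt0 R G.
  suff : Num.sqrt (2 / n%:R) <= (A * M ^+ 2)^-1.
    move=> h; rewrite [leRHS]mulrC mulrA ler_wpM2r //.
    apply: le_trans (ler_wpM2r (ltW A0) h) _.
    by rewrite invfM mulrAC mulVf ?mul1r // gt_eqF.
  rewrite -[leRHS]ger0_norm ?invr_ge0 ?(ltW AM) // -sqrtr_sqr ler_sqrt ?sqr_ge0 //.
  have n0 : 0 < n%:R :> R by rewrite ltr0n.
  rewrite exprVn ler_pdivrMr // mulrC ler_pdivlMr ?exprn_gt0 //.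
  have := truncnS_gt (2 * A ^+ 2 * M ^+ 4); rewrite -/n.
  have -> : 2 * A ^+ 2 * M ^+ 4 = 2 * (A * M ^+ 2) ^+ 2 by ring.
  by move/ltW.
Qed.

Lemma level_growth_ge1 A M : 1 <= level_growth A M.
Proof.
have : (2 : R) <= sign_wiener (Num.truncn (2 * A ^+ 2 * M ^+ 4)).+1 2.
  by apply: sign_wiener_ge; lra.
by rewrite /level_growth; lra.
Qed.

Lemma level_growth_homo A M N : 0 < M -> M <= N -> level_growth A M <= level_growth A N.
Proof.
move=> M0 MN; rewrite /level_growth ler_pM2r // lerD2l.
apply: sign_wiener_homo; first by lra.
rewrite ltnS; apply: Num.Theory.le_truncn; apply: ler_wpM2l.
  by rewrite mulr_ge0 ?sqr_ge0.
by rewrite ler_pXn2r ?nnegrE //; lra.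
Qed.

End Approximable.

(** * Choice of a regular threshold *)

Section Threshold.
Variables (R : realType).

(** Telescoping with 1 / sqrt (n + 1) <= 2 (sqrt (n + 1) - sqrt n). *)
Lemma sum_inv_sqrt_le (P q : R) n : 0 <= q ->
  \sum_(0 <= k < n.+1) (if k == 0%N then P else q / Num.sqrt k%:R) <=
  P + 2 * q * Num.sqrt n%:R.
Proof.
move=> q0; elim: n => [|n IH]; first by rewrite big_nat1 sqrtr0 mulr0 addr0.
rewrite big_nat_recr //=; apply: le_trans (lerD IH (lexx _)) _.
have : Num.sqrt n.+1%:R ^+ 2 = Num.sqrt n%:R ^+ 2 + 1 :> R.
  by rewrite !sqr_sqrtr // natr1.
have : 0 < Num.sqrt n.+1%:R :> R by rewrite sqrtr_gt0.
set a := Num.sqrt n%:R; set b := Num.sqrt _ => b0 ba.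
suff : b^-1 <= 2 * (b - a) by move/(ler_wpM2l q0); lra.
by rewrite -[leLHS]mul1r ler_pdivrMr //; have := sqr_ge0 (b - a); nra.
Qed.

(* If [m <= v < m + 1] then [gap m i <= |v - (i + 1)|]. *)
Let gap (m i : nat) := if (i < m)%N then (m - i.+1)%N else (i - m)%N.

(** On each side of [m] the gap takes every value at most once. *)
Lemma sum_gap_le (psi : nat -> R) (m N : nat) : (m <= N)%N -> (forall k, 0 <= psi k) ->
  \sum_(0 <= i < N) psi (gap m i) <= 2 * \sum_(0 <= k < N) psi k.
Proof.
move=> mN psi0; rewrite (big_cat_nat (n := m)) //= mulr_natl mulr2n.
have trunc p : (p <= N)%N -> \sum_(0 <= k < p) psi k <= \sum_(0 <= k < N) psi k.
  move=> pN; rewrite [leRHS](big_cat_nat (n := p)) //= lerDl.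
  by apply: sumr_ge0.
apply: lerD.
  rewrite big_nat_rev /= add0n (eq_big_nat _ _ (F2 := psi)) ?trunc // => i /andP[_ im].
  by rewrite /gap ifT; [congr psi; lia|lia].
rewrite -{1}[m]add0n big_addn (eq_big_nat _ _ (F2 := psi)) ?trunc ?leq_subr // => i _.
by rewrite /gap ifF; [congr psi; lia|lia].
Qed.

Lemma ex_ler_sum N (F : nat -> R) (a : R) : N%:R * a <= \sum_(0 <= i < N) F i ->
  (0 < N)%N -> exists2 i, (i < N)%N & a <= F i.
Proof.
move=> h N0; rewrite big_mkord in h.
have [/existsP[i ai]|] := boolP [exists i : 'I_N, a <= F i]; first by exists i.
rewrite negb_exists => /forallP H; move: h; rewrite leNgt => /negP[].
have -> : N%:R * a = \sum_(i < N) a by rewrite sumr_const card_ord mulr_natl.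
apply: ltr_sum => [|i _]; last by rewrite ltNge.
by apply/hasP; exists (Ordinal N0); rewrite ?mem_index_enum.
Qed.

Variable G : finZmodType.

(* Averages over a grid of thresholds a correlation minus a multiple of the
   potential [sum_x |w x - t|^(-1/2)], truncated by the large value [P] near the
   grid point so that the chosen threshold avoids the values of [w]. *)
Lemma regular_threshold (c : R) (w g : G -> R) : 0 < c ->
  (forall x, 0 <= w x <= 1) -> (forall x, `|g x| <= 2) ->
  c * #|G|%:R <= \sum_x g x * w x ->
  exists t : R, [/\ 0 <= t <= 1, forall x, w x - t != 0,
    \sum_x (Num.sqrt `|w x - t|)^-1 <= 40 / c * #|G|%:R &
    c / 4 * #|G|%:R <= \sum_x g x * (0 < w x - t)%R%:R].
Proof.
move=> c0 w01 g2 hgw; have G0 := natr_card_gt0 R G.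
set n : R := #|G|%:R in hgw G0 *.
(* Just above the bound [Phin] below, so that no gap at the chosen index can be 0. *)
pose P : R := 40 / c * n + 1.
have P0 : 0 < P by rewrite /P ltr_pwDr // mulr_ge0 ?divr_ge0 ?ltW.
(* [N >= 2 * P] makes twice the sum of [psi] at most 5 N; [N >= 4 / c] absorbs the rounding loss in
   [sumX]. *)
pose N := (Num.truncn (2 * P + 4 / c)).+1.
have c4 : 0 < 4 / c by rewrite divr_gt0.
have NP : 2 * P + 4 / c <= N%:R by exact/ltW/truncnS_gt.
have N0 : 0 < N%:R :> R by rewrite ltr0n.
have N1 : N%:R != 0 :> R by rewrite gt_eqF.
pose m x := Num.truncn (N%:R * w x).
have wx0 x : 0 <= N%:R * w x by rewrite mulr_ge0 ?(ltW N0) //; have /andP[] := w01 x.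
have mlb x : (m x)%:R <= N%:R * w x by rewrite truncn_le.
have mub x : N%:R * w x < (m x)%:R + 1 by rewrite natr1 truncnS_gt.
have mN x : (m x <= N)%N.
  rewrite -(ler_nat R); apply: le_trans (mlb x) _.
  by rewrite ler_piMr ?(ltW N0) //; have /andP[] := w01 x.
(* The power -1/2 of the distance k / N, truncated at 0. *)
pose psi k : R := if k == 0%N then P else Num.sqrt N%:R / Num.sqrt k%:R.
have psi0 k : 0 <= psi k by rewrite /psi; case: ifP => _; rewrite ?(ltW P0) // divr_ge0 ?sqrtr_ge0.
have psum : \sum_(0 <= k < N) psi k <= P + 2 * N%:R.
  apply: le_trans (sum_inv_sqrt_le P _ (sqrtr_ge0 _)) _.
  rewrite lerD2l -mulrA ler_pM2l // -[leRHS]sqr_sqrtr ?(ltW N0) // expr2.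
  by rewrite ler_wpM2l ?sqrtr_ge0 // ler_sqrt ?ler_nat // ltW.
(* [i < m x] says that the grid point (i + 1) / N is at most [w x]. *)
pose X i := \sum_x g x * (i < m x)%N%:R.
pose Phi i := \sum_x psi (gap (m x) i).
have sumX : N%:R * c * n - 2 * n <= \sum_(0 <= i < N) X i.
  rewrite exchange_big /=.
  apply: (@le_trans _ _ (\sum_x (N%:R * (g x * w x) - 2))).
    rewrite sumrB -mulr_sumr sumr_const -[2 *+ _]mulr_natr lerD2r -mulrA.
    by rewrite ler_pM2l.
  apply: ler_sum => x _; rewrite -mulr_sumr.
  have -> : \sum_(0 <= i < N) (i < m x)%N%:R = (m x)%:R :> R.
    rewrite (big_cat_nat (n := m x)) //= [X in _ + X]big_nat_cond.
    rewrite [X in _ + X]big1 ?addr0 => [|i /andP[/andP[mi _] _]]; last by rewrite ltnNge mi.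
    rewrite (eq_big_nat _ _ (F2 := fun=> 1)) => [|i /andP[_ ->]//].
    by rewrite sumr_const_nat subn0.
  have /ler_normlP[_ g2x] := g2 x; have := mlb x; have := mub x => h1 h2.
  have : 0 <= (2 - g x) * (N%:R * w x - (m x)%:R) by rewrite mulr_ge0 // subr_ge0.
  by lra.
have sumPhi : \sum_(0 <= i < N) Phi i <= 5 * N%:R * n.
  rewrite exchange_big /= mulrC /n -sum_const_G; apply: ler_sum => x _.
  apply: le_trans (sum_gap_le (mN x) psi0) _.
  by move: psum NP c4; lra.
(* Of the total N c n, the potential costs at most a quarter, as 5 / 20 = 1 / 4, and rounding at
   most a half. *)
have [i iN hi] : exists2 i, (i < N)%N & c / 4 * n <= X i - c / 20 * Phi i.
  apply: ex_ler_sum => //; rewrite sumrB -mulr_sumr.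
  apply: le_trans (lerB sumX (ler_wpM2l _ sumPhi)); last by rewrite divr_ge0 ?ltW.
  have : 2 * n <= N%:R * c / 2 * n.
    rewrite ler_wpM2r ?(ltW G0) //.
    have : 4 / c * c <= N%:R * c by rewrite ler_wpM2r ?(ltW c0) //; move: NP P0; lra.
    by rewrite divfK ?gt_eqF //; lra.
  by lra.
have Phi0 : 0 <= Phi i by apply: sumr_ge0.
have X2 : X i <= 2 * n.
  rewrite mulrC /n -sum_const_G; apply: ler_sum => x _.
  have /ler_normlP[] := g2 x; case: (i < m x)%N; rewrite ?mulr1 ?mulr0; lra.
have cPhi : c / 20 * Phi i <= 2 * n.
  have : 0 <= c / 4 * n by rewrite mulr_ge0 ?divr_ge0 ?ltW.
  by lra.
(* From [X i <= 2 * n], since 2 divided by c / 20 is 40 / c. *)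
have Phin : Phi i <= 40 / c * n.
  rewrite mulrAC ler_pdivlMr //; lra.
have k0 x : gap (m x) i != 0%N.
  apply/eqP => k0; suff : P <= Phi i by rewrite /P; lra.
  rewrite /Phi (bigD1 x) //= k0 -[P]/(psi 0%N) lerDl; exact: sumr_ge0.
pose t : R := i.+1%:R / N%:R.
have Nt : N%:R * t = i%:R + 1 by rewrite mulrC divfK // natr1.
have dist x : (0 < w x - t) = (i < m x)%N /\ (gap (m x) i)%:R / N%:R <= `|w x - t|.
  have := k0 x; have := mlb x; have := mub x; rewrite /gap.
  case: ltnP => im h1 h2 h3.
    have h4 : (m x)%:R = (m x - i.+1)%:R + i%:R + 1 :> R by rewrite -addrA natr1 -natrD subnK.
    have h5 : 1 <= (m x - i.+1)%:R :> R by rewrite ler1n lt0n.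
    have d0 : 0 < N%:R * (w x - t) by rewrite mulrBr Nt; lra.
    have {}d0 : 0 < w x - t by rewrite pmulr_rgt0 in d0.
    split=> //; rewrite gtr0_norm // ler_pdivrMr // mulrC mulrBr Nt; lra.
  have h4 : i%:R = (i - m x)%:R + (m x)%:R :> R by rewrite -natrD subnK.
  have h5 : 1 <= (i - m x)%:R :> R by rewrite ler1n lt0n.
  have d0 : N%:R * (w x - t) < 0 by rewrite mulrBr Nt; lra.
  have {}d0 : w x - t < 0 by rewrite pmulr_rlt0 in d0.
  split; first by rewrite lt_gtF.
  rewrite ltr0_norm // ler_pdivrMr // mulrC mulrN mulrBr Nt; lra.
have gpos x : 0 < (gap (m x) i)%:R :> R by rewrite ltr0n lt0n.
have dpos x : 0 < `|w x - t| by have [_] := dist x; apply: lt_le_trans; rewrite divr_gt0.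
exists t; split.
- by rewrite /t divr_ge0 ?(ltW N0) //= ler_pdivrMr // mul1r ler_nat.
- by move=> x; rewrite -normr_gt0.
- apply: le_trans Phin; apply: ler_sum => x _; rewrite /psi (negPf (k0 x)).
  rewrite -[leRHS]invf_div lef_pV2 ?posrE ?sqrtr_gt0 ?divr_gt0 ?sqrtr_gt0 //.
  rewrite -sqrtrV ?(ltW N0) // -sqrtrM ?(ltW (gpos x)) // ler_sqrt ?(ltW (dpos x)) //.
  by have [] := dist x.
- under eq_bigr => x _ do rewrite (dist x).1.
  rewrite -/(X i); have : 0 <= c / 20 * Phi i by rewrite mulr_ge0 // divr_ge0 ?ltW.
  by lra.
Qed.

End Threshold.

(** * Conditional expectation and energy decrement *)

Section ConditionalExpectation.
Variables (R : realType) (G : finZmodType).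
Implicit Types (a : G -> R).

Definition fiber_avg (T : finType) (c : G -> T) a (t : T) : R :=
  avg [set y | c y == t] a.

Definition residual (T : finType) (c : G -> T) a :=
  \sum_x (a x - fiber_avg c a (c x)) ^+ 2.

Lemma fiber_avg_orthogonal (T : finType) (c : G -> T) a (h : T -> R) :
  \sum_x (a x - fiber_avg c a (c x)) * h (c x) = 0.
Proof.
rewrite (partition_big c xpredT) //= big1 // => t _.
under eq_bigr => x /eqP -> do rewrite mulrC.
rewrite -mulr_sumr sumrB sumr_const /fiber_avg /avg.
have -> : \sum_(x in [set y | c y == t]) a x = \sum_(x | c x == t) a x.
  by apply: eq_bigl => x; rewrite inE.
rewrite cardsE -[_ *+ _]mulr_natr.
(* A value [t] that is not attained has an empty fiber, on which all sums vanish. *)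
have [n0|n0] := eqVneq #|[pred x | c x == t]| 0%N; last first.
  by rewrite divfK ?pnatr_eq0 // subrr mulr0.
have E x : (c x == t) = false by have := card0_eq n0 x; rewrite inE.
by rewrite !big_pred0 // !mul0r subrr mulr0.
Qed.

(** Pythagoras: the cross term vanishes by [fiber_avg_orthogonal]. *)
Lemma residual_le (T : finType) (c : G -> T) a (h : T -> R) :
  residual c a <= \sum_x (a x - h (c x)) ^+ 2.
Proof.
pose d t := fiber_avg c a t - h t.
have -> : \sum_x (a x - h (c x)) ^+ 2 = residual c a +
    2 * \sum_x (a x - fiber_avg c a (c x)) * d (c x) + \sum_x d (c x) ^+ 2.
  rewrite mulr_sumr -!big_split /=; apply: eq_bigr => x _; rewrite /d; ring.
rewrite fiber_avg_orthogonal mulr0 addr0 lerDl.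
by apply: sumr_ge0 => x _; exact: sqr_ge0.
Qed.

Lemma residual_ge0 (T : finType) (c : G -> T) a : 0 <= residual c a.
Proof. by apply: sumr_ge0 => x _; exact: sqr_ge0. Qed.

Lemma fiber_avg_bound (T : finType) (c : G -> T) a k t : 0 <= k ->
  (forall x, `|a x| <= k) -> `|fiber_avg c a t| <= k.
Proof.
move=> k0 ak; rewrite /fiber_avg /avg; set S := [set y | _].
have [->|S0] := eqVneq S finset.set0; first by rewrite big_set0 mul0r normr0.
have n0 : 0 < #|S|%:R :> R by rewrite ltr0n card_gt0.
rewrite normrM normfV normr_nat ler_pdivrMr //.
apply: le_trans (ler_norm_sum _ _ _) _; rewrite mulr_natr -sumr_const.
by apply: ler_sum.
Qed.

Variables (T : finType) (c : G -> T).

Lemma residual_refine a (b : G -> bool) :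
  residual (fun x => (c x, b x)) a <= residual c a.
Proof. exact: (residual_le _ _ (fun p => fiber_avg c a p.1)). Qed.

(** The competitor is the old average plus [eta] times the indicator of [b]. The cross term gains at
    least 2 eta^2 |G| and the square costs at most eta^2 |G|. *)
Lemma residual_decrement a (b : G -> bool) (eta : R) : 0 <= eta ->
  eta * #|G|%:R <= \sum_x (a x - fiber_avg c a (c x)) * (b x)%:R ->
  residual (fun x => (c x, b x)) a <= residual c a - eta ^+ 2 * #|G|%:R.
Proof.
move=> eta0 h.
apply: le_trans (residual_le (fun x => (c x, b x)) a
  (fun p : T * bool => fiber_avg c a p.1 + eta * p.2%:R)) _ => /=.
have b2 : \sum_x (b x)%:R ^+ 2 <= #|G|%:R :> R.
  rewrite -[leRHS]mulr1 -sum_const_G; apply: ler_sum => x _.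
  by case: (b x); rewrite ?expr1n ?expr0n.
have -> : \sum_x (a x - (fiber_avg c a (c x) + eta * (b x)%:R)) ^+ 2 = residual c a -
    2 * eta * (\sum_x (a x - fiber_avg c a (c x)) * (b x)%:R) +
    eta ^+ 2 * \sum_x (b x)%:R ^+ 2.
  rewrite !mulr_sumr -sumrB -big_split /=; apply: eq_bigr => x _; ring.
have := ler_wpM2l (sqr_ge0 eta) b2; have := ler_wpM2l eta0 h.
by lra.
Qed.

End ConditionalExpectation.

(** * The dual function of the U2 norm *)

Section DualFunction.
Variables (R : realType) (G : finZmodType).
Local Notation "x %:C" := (real_complex _ x).
Local Notation Re := complex.Re.
Local Notation Im := complex.Im.

Lemma Re_sum (I : Type) (s : seq I) (P : pred I) (F : I -> R[i]) :
  Re (\sum_(i <- s | P i) F i) = \sum_(i <- s | P i) Re (F i).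
Proof. by elim/big_rec2: _ => // i x z _ <-; case: (F i) z => [? ?] []. Qed.

Lemma Im_sum (I : Type) (s : seq I) (P : pred I) (F : I -> R[i]) :
  Im (\sum_(i <- s | P i) F i) = \sum_(i <- s | P i) Im (F i).
Proof. by elim/big_rec2: _ => // i x z _ <-; case: (F i) z => [? ?] []. Qed.

Lemma complex_divn (z : R[i]) n : z / n%:R = Complex (Re z / n%:R) (Im z / n%:R).
Proof.
rewrite -(rmorph_nat (real_complex R)) -fmorphV; case: z => a b.
by apply/eqP; rewrite eq_complex /= !(mulr0, subr0, addr0, add0r) !eqxx.
Qed.

Lemma Re_avg (T : finType) (S : {set T}) (F : T -> R[i]) :
  Re (avg S F) = avg S (fun x => Re (F x)).
Proof. by rewrite /avg complex_divn /= Re_sum. Qed.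

Lemma Im_avg (T : finType) (S : {set T}) (F : T -> R[i]) :
  Im (avg S F) = avg S (fun x => Im (F x)).
Proof. by rewrite /avg complex_divn /= Im_sum. Qed.

Variables (f : G -> R[i]).
Let a x := Re (f x).
Let b x := Im (f x).
Let n : R := #|G|%:R.

(** With [autocorr_im], the real and imaginary parts of the sum over [y] of the conjugate of f(y)
    times f(y + h). *)
Definition autocorr_re h := \sum_y (a y * a (y + h) + b y * b (y + h)).
Definition autocorr_im h := \sum_y (a y * b (y + h) - b y * a (y + h)).

(* [dual_re - i dual_im] is the function [D] with [U2_avg f = E_x f(x) D(x)]. *)
Definition dual_re x := \sum_h (autocorr_re h / n ^+ 2) * a (x + h) +
  \sum_h (autocorr_im h / n ^+ 2) * b (x + h).
Definition dual_im x := \sum_h (autocorr_re h / n ^+ 2) * b (x + h) +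
  \sum_h (- (autocorr_im h / n ^+ 2)) * a (x + h).

Lemma U2_avg_dual : Re (U2_avg f) * n = \sum_x (a x * dual_re x + b x * dual_im x).
Proof.
have n0 : n != 0 by rewrite gt_eqF // natr_card_gt0.
rewrite /U2_avg Re_avg /avg.
have -> : #|[set: G * G * G]|%:R = n ^+ 3 by rewrite cardsT !card_prod !natrM /n; ring.
(* With y = x + h2, each term of the U2 sum is f(x) conj f(x + h) times conj f(y) f(y + h); [F] is
   its real part. *)
pose F x h y : R := (a x * a (x + h) + b x * b (x + h)) * (a y * a (y + h) + b y * b (y + h))
  - (b x * a (x + h) - a x * b (x + h)) * (a y * b (y + h) - b y * a (y + h)).
have -> : \sum_(t in [set: G * G * G]) Re (let: (x, h1, h2) := t in
    f x * conjc (f (x + h1) * f (x + h2)) * f (x + h1 + h2)) =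
    \sum_x \sum_h \sum_y F x h y.
  under eq_bigl do rewrite finset.in_setT.
  transitivity (\sum_(t : G * G * G) F t.1.1 t.1.2 (t.1.1 + t.2)).
    apply: eq_bigr => [[[x h1] h2]] _ /=; rewrite /F (addrAC x h2) /a /b.
    by case: (f x) (f (x + h1)) (f (x + h2)) (f (x + h1 + h2)) => [? ?] [? ?] [? ?] [? ?] /=; ring.
  rewrite -(pair_bigA _ (fun p h2 => F p.1 p.2 (p.1 + h2))) /=.
  rewrite -(pair_bigA _ (fun x h1 => \sum_h2 F x h1 (x + h2))) /=.
  apply: eq_bigr => x _; apply: eq_bigr => h _.
  by rewrite [RHS](reindex_inj (addrI x)).
rewrite mulrC mulrA; apply/(canLR (mulfK _)); first by rewrite expf_neq0.
rewrite mulr_sumr mulr_suml; apply: eq_bigr => x _.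
have -> : \sum_h \sum_y F x h y = n ^+ 2 * (a x * dual_re x + b x * dual_im x).
  rewrite /dual_re /dual_im !mulrDr !mulr_sumr -!big_split /=; apply: eq_bigr => h _.
  rewrite sumrB -!mulr_sumr -/(autocorr_re h) -/(autocorr_im h).
  by field.
by ring.
Qed.

Hypotheses (a2 : forall x, `|a x| <= 2) (b2 : forall x, `|b x| <= 2).

Lemma autocorr_bound h : `|autocorr_re h / n ^+ 2| <= 8 / n /\ `|autocorr_im h / n ^+ 2| <= 8 / n.
Proof.
have n0 : 0 < n by exact: natr_card_gt0.
have M4 (u v : R) : `|u| <= 2 -> `|v| <= 2 -> `|u * v| <= 4.
  by move=> ? ?; rewrite normrM -[4]/(2 * 2)%:R natrM ler_pM.
suff S (F : G -> R) : (forall y, `|F y| <= 8) -> `|(\sum_y F y) / n ^+ 2| <= 8 / n.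
  split; apply: S => y; first apply: le_trans (ler_normD _ _) _.
    by have := M4 _ _ (a2 y) (a2 (y + h)); have := M4 _ _ (b2 y) (b2 (y + h)); lra.
  apply: le_trans (ler_normB _ _) _.
  by have := M4 _ _ (a2 y) (b2 (y + h)); have := M4 _ _ (b2 y) (a2 (y + h)); lra.
move=> F8; rewrite normrM (ger0_norm (_ : 0 <= (n ^+ 2)^-1)) ?invr_ge0 ?exprn_ge0 ?(ltW n0) //.
have -> : 8 / n = (n * 8) / n ^+ 2 by field; rewrite gt_eqF.
rewrite ler_pM2r ?invr_gt0 ?exprn_gt0 // /n -sum_const_G.
by apply: le_trans (ler_norm_sum _ _ _) _; exact: ler_sum.
Qed.

(** Each part is a sum of two correlations to which [wiener_conv] applies with k = 8. *)
Lemma wiener_dual : wiener 128 dual_re /\ wiener 128 dual_im.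
Proof.
have le8 (u : R) : `|u| <= 2 -> `|u| <= 8 by move=> ?; lra.
have E : 128 = 8 ^+ 2 + 8 ^+ 2 :> R by ring.
rewrite E; split; apply: wienerD; apply: wiener_conv => y; rewrite ?normrN;
  by [have [] := autocorr_bound y | apply: le8].
Qed.

End DualFunction.

(** * One refinement of the factor *)

Section Step.
Variables (R : realType) (G : finZmodType).
Local Notation Re := complex.Re.
Local Notation Im := complex.Im.

Lemma U2_norm_gt (delta : R) (g : G -> R[i]) : 0 < delta ->
  delta < U2_norm g -> delta ^+ 4 < Re (U2_avg g).
Proof.
move=> d0; apply: contraTT; rewrite -!leNgt => h.
rewrite /U2_norm -[leRHS](gtr0_norm d0) -sqrtr_sqr ler_sqrt ?sqr_ge0 //.
rewrite -[leRHS]ger0_norm ?sqr_ge0 // -sqrtr_sqr ler_sqrt ?sqr_ge0 //.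
by rewrite -exprM.
Qed.

Lemma normr_Re (z : R[i]) : `|Re z| <= normc z.
Proof. by case: z => u v; rewrite -sqrtr_sqr ler_wsqrtr // lerDl sqr_ge0. Qed.

Lemma normr_Im (z : R[i]) : `|Im z| <= normc z.
Proof. by case: z => u v; rewrite -sqrtr_sqr ler_wsqrtr // lerDr sqr_ge0. Qed.

Lemma factor_avg_preim (T : finType) (c : G -> T) (f : G -> R[i]) x :
  factor_avg (preim_partition c [set: G]) f x =
  Complex (fiber_avg c (fun y => Re (f y)) (c x)) (fiber_avg c (fun y => Im (f y)) (c x)).
Proof.
rewrite /factor_avg /fiber_avg.
have -> : finset.pblock (preim_partition c [set: G]) x = [set y | c y == c x].
  apply/setP => y; rewrite inE pblock_equivalence_partition ?finset.in_setT 1?eq_sym //.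
  by split=> // /eqP ->.
by rewrite -Re_avg -Im_avg; case: (avg _ _).
Qed.

Lemma preim_partition_card (T : finType) (c : G -> T) :
  (#|preim_partition c [set: G]| <= #|T|)%N.
Proof.
apply: leq_trans (leq_imset_card (fun t => [set y | t == c y]) T).
apply: subset_leq_card; apply/fintype.subsetP => E /imsetP[x _ ->].
apply/imsetP; exists (c x) => //; apply/setP => y.
by rewrite !inE.
Qed.

Lemma set_measurable1_preim (T : finType) (c : G -> T) (F : R -> R)
    (F' : {posnum R} -> {posnum R}) E :
  (forall t, approximable F (fun x => (c x == t)%:R)) ->
  (forall M : {posnum R}, F M%:num <= (F' M)%:num) ->
  E \in preim_partition c [set: G] -> set_measurable1 F' E.
Proof.
move=> hF FF' /imsetP[x0 _ ->].
have EE x : (x \in [set y in [set: G] | c x0 == c y])%:R = real_complex R (c x == c x0)%:R.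
  by rewrite !inE eq_sym; case: (_ == _).
split=> [x|M]; first by rewrite EE normc_real; case: (_ == _); rewrite ?normr0 ?normr1.
have M0 : 0 < M%:num by [].
have [phi [p1 p2 p3]] := hF (c x0) _ M0.
exists (fun x => real_complex R (phi x)); split=> [x||].
- by rewrite normc_real ger0_norm; have /andP[] := p1 x.
- exact: le_trans (fourier_norm1_wiener p2) (FF' M).
rewrite /norm2 -[leRHS]ger0_norm // -sqrtr_sqr ler_wsqrtr // /avg cardsT.
rewrite ler_pdivrMr ?natr_card_gt0 // mulrC exprVn.
under eq_bigl do rewrite finset.in_setT.
apply: le_trans p3; apply: ler_sum => x _ /=.
by rewrite EE -rmorphB normc_real real_normK ?num_real.
Qed.

Variables (T : finType) (c : G -> T).

Lemma correlated_level_set (c0 : R) (a r : G -> R) : 0 < c0 ->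
  (forall x, `|a x| <= 1) -> wiener 128 r ->
  256 * c0 * #|G|%:R <= \sum_x (a x - fiber_avg c a (c x)) * r x ->
  exists b : G -> bool,
    approximable (level_growth (40 / c0)) (fun x => (b x)%:R) /\
    c0 / 4 * #|G|%:R <= \sum_x (a x - fiber_avg c a (c x)) * (b x)%:R.
Proof.
(* The affine map sends [-128, 128] to [0, 1]. The constant does not affect the correlation, as [g]
   has mean zero; the slope divides it by 256. *)
move=> c00 a1 wr hr; pose w x := 2^-1 + 256^-1 * r x.
pose g x := a x - fiber_avg c a (c x).
have w01 x : 0 <= w x <= 1 by have := wiener_abs x wr; rewrite ler_norml /w; lra.
have g2 x : `|g x| <= 2.
  apply: le_trans (ler_normB _ _) _; have := a1 x.
  by have := @fiber_avg_bound _ _ _ c a 1 (c x) ler01 a1; lra.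
have gw : c0 * #|G|%:R <= \sum_x g x * w x.
  have -> : \sum_x g x * w x = 2^-1 * (\sum_x g x * 1) + 256^-1 * \sum_x g x * r x.
    rewrite !mulr_sumr -big_split; apply: eq_bigr => x _ /=; rewrite /w; ring.
  by rewrite (fiber_avg_orthogonal c a (fun=> 1)); move: hr; rewrite /g; lra.
have [t [t01 s0 hA hX]] := regular_threshold c00 w01 g2 gw.
exists (fun x => 0 < w x - t); split=> //.
apply: level_approximable => //.
- by rewrite divr_gt0.
- have le2 : `|256^-1| * 128 + `|2^-1 - t| <= 2.
    have : `|2^-1 - t| <= 1 by rewrite ler_norml; lra.
    by rewrite ger0_norm ?invr_ge0 ?ler0n //; lra.
  have := wiener_le le2 (wienerD (wienerZ 256^-1 wr) (wiener_cst G (2^-1 - t))).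
  by apply: wiener_ext => x; rewrite /w; ring.
- by move=> x; have := w01 x; rewrite ler_norml; lra.
Qed.

Definition total_residual (T : finType) (c : G -> T) (f : G -> R[i]) :=
  residual c (fun x => Re (f x)) + residual c (fun x => Im (f x)).

Lemma refine_step (delta : R) (f : G -> R[i]) (c0 := delta ^+ 4 / 512) :
  0 < delta -> bounded1 f ->
  delta < U2_norm (f \- factor_avg (preim_partition c [set: G]) f) ->
  exists b : G -> bool,
    approximable (level_growth (40 / c0)) (fun x => (b x)%:R) /\
    total_residual (fun x => (c x, b x)) f <=
      total_residual c f - (c0 / 4) ^+ 2 * #|G|%:R.
Proof.
move=> d0 f1 /(U2_norm_gt d0); set g := (X in U2_avg X) => hg.
have c00 : 0 < c0 by apply: divr_gt0; [exact: exprn_gt0 | rewrite ltr0n].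
have c40 : 0 <= c0 / 4 by apply/ltW/divr_gt0; rewrite ?ltr0n.
pose a x := Re (f x); pose b x := Im (f x).
have a1 x : `|a x| <= 1 by apply: le_trans (f1 x); exact: normr_Re.
have b1 x : `|b x| <= 1 by apply: le_trans (f1 x); exact: normr_Im.
have gE x : g x = Complex (a x - fiber_avg c a (c x)) (b x - fiber_avg c b (c x)).
  by rewrite /g /= factor_avg_preim /a /b; case: (f x).
have le2 (h : G -> R) : (forall x, `|h x| <= 1) ->
    forall x, `|h x - fiber_avg c h (c x)| <= 2.
  move=> h1 x; apply: le_trans (ler_normB _ _) _; have := h1 x.
  by have := @fiber_avg_bound _ _ _ c h 1 (c x) ler01 h1; lra.
have [w1 w2] : wiener 128 (dual_re g) /\ wiener 128 (dual_im g).
  by apply: wiener_dual => x; rewrite gE /=; exact: le2.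
have G0 := natr_card_gt0 R G.
have : delta ^+ 4 * #|G|%:R <= \sum_x (a x - fiber_avg c a (c x)) * dual_re g x +
    \sum_x (b x - fiber_avg c b (c x)) * dual_im g x.
  rewrite -big_split /= (eq_bigr (fun x => Re (g x) * dual_re g x + Im (g x) * dual_im g x)).
    by rewrite -U2_avg_dual ler_pM2r // ltW.
  by move=> x _; rewrite gE.
have E : 512 * c0 = delta ^+ 4 by rewrite /c0; field.
(* The two correlations add up to at least 512 c0 |G|, so one is at least half of that. Refining by
   its level set lowers the residual of that part and does not raise the other. *)
have [hr|hr] := leP (256 * c0 * #|G|%:R) (\sum_x (a x - fiber_avg c a (c x)) * dual_re g x).
  move=> _; have [d [hd hX]] := correlated_level_set c00 a1 w1 hr.
  exists d; split=> //; rewrite /total_residual.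
  have := residual_decrement c40 hX; have := residual_refine c b d.
  by rewrite -/a -/b; lra.
move=> hs.
have {}hr : 256 * c0 * #|G|%:R <= \sum_x (b x - fiber_avg c b (c x)) * dual_im g x.
  by move: hs hr; rewrite -E; lra.
have [d [hd hX]] := correlated_level_set c00 b1 w2 hr.
exists d; split=> //; rewrite /total_residual.
have := residual_decrement c40 hX; have := residual_refine c a d.
by rewrite -/a -/b; lra.
Qed.

End Step.

(** * Growth after several refinements *)

Section Growth.
Variable R : realType.

(** Each refinement multiplies indicators, hence the doubling of [M] from [approximableM]; the
    summand 1 pays for complements of level sets. *)
Fixpoint factor_growth (A : R) (k : nat) (M : R) : R :=
  if k is k'.+1 then factor_growth A k' (2 * M) * (1 + level_growth A (2 * M)) else 1.

Lemma factor_growth_ge1 A k M : 1 <= factor_growth A k M.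
Proof.
elim: k M => [|k IH] M //=; rewrite -{1}[1]mulr1 ler_pM //.
by have := level_growth_ge1 A (2 * M); lra.
Qed.

Lemma factor_growth_homo A k M N : 0 < M -> M <= N ->
  factor_growth A k M <= factor_growth A k N.
Proof.
elim: k M N => [|k IH] M N M0 MN //=.
have M20 : 0 < 2 * M by rewrite mulr_gt0.
have MN2 : 2 * M <= 2 * N by rewrite ler_pM2l.
have h1 := factor_growth_ge1 A k (2 * M).
have h2 := level_growth_ge1 A (2 * M).
by apply: ler_pM; [lra|lra|exact: IH|rewrite lerD2l level_growth_homo].
Qed.

Lemma factor_growthS A k M : 0 < M -> factor_growth A k M <= factor_growth A k.+1 M.
Proof.
move=> M0 /=; have h1 := factor_growth_ge1 A k (2 * M).
have h2 := level_growth_ge1 A (2 * M).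
apply: (@le_trans _ _ (factor_growth A k (2 * M))); first by apply: factor_growth_homo; lra.
by rewrite ler_peMr; lra.
Qed.

Definition posnum_growth A k (M : {posnum R}) : {posnum R} :=
  PosNum (lt_le_trans ltr01 (factor_growth_ge1 A k M%:num)).

End Growth.

(** * Iterated refinement *)

Section Iteration.
Variables (R : realType) (G : finZmodType) (f : G -> R[i]) (delta : R).
Hypotheses (d0 : 0 < delta) (f1 : bounded1 f).
Let c0 := delta ^+ 4 / 512.
Let A := 40 / c0.

Definition fibers_approximable (T : finType) (c : G -> T) k :=
  forall t, approximable (factor_growth A k) (fun x => (c x == t)%:R : R).

Lemma refine_approximable (T : finType) (c : G -> T) k (b : G -> bool) :
  fibers_approximable c k -> approximable (level_growth A) (fun x => (b x)%:R) ->
  fibers_approximable (fun x => (c x, b x)) k.+1.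
Proof.
move=> hc hb [t e].
have {}hb : approximable (fun M => 1 + level_growth A M) (fun x => (b x == e)%:R : R).
  case: e.
    apply: approximable_ext (approximable_le _ hb) => [x|M _]; first by rewrite eqb_id.
    by rewrite lerDr.
  apply: approximable_ext (approximableC hb) => x.
  by case: (b x); rewrite ?subrr ?subr0.
have b01 (e' : bool) : 0 <= (e'%:R : R) <= 1 by case: e'; rewrite ?lexx ?ler01.
have := approximableM (fun x => b01 (c x == t)) (fun x => b01 (b x == e)) (hc t) hb.
apply: approximable_ext => x.
by rewrite -natrM mulnb.
Qed.

Lemma iterate_refinement k :
  exists (T : finType) (c : G -> T), [/\ (#|T| <= 2 ^ k)%N, fibers_approximable c k &
    U2_norm (f \- factor_avg (preim_partition c [set: G]) f) <= delta \/
    total_residual c f <= (8 - k%:R * (c0 / 4) ^+ 2) * #|G|%:R].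
Proof.
elim: k => [|k [T [c [cT hc hk]]]].
  exists unit, (fun=> tt); split; first by rewrite card_unit.
    by case; exact: approximable1.
  (* The real and imaginary parts each differ from their means by at most 2, whence the initial
     bound 4 + 4 = 8. *)
  right; rewrite mul0r subr0 mulrC -sum_const_G /total_residual -big_split /=.
  have sq4 (h : G -> R) x : (forall y, `|h y| <= 1) ->
      (h x - fiber_avg (fun=> tt) h tt) ^+ 2 <= 4.
    move=> h1; have := h1 x; have := fiber_avg_bound (fun=> tt) tt ler01 h1.
    move=> e1 h1x; rewrite -(real_normK (num_real _)) -[4](_ : 2 ^+ 2 = _); last by ring.
    rewrite ler_pXn2r ?nnegrE //; apply: le_trans (ler_normB _ _) _; lra.
  apply: ler_sum => x _.
  have ha y : `|complex.Re (f y)| <= 1 by apply: le_trans (f1 y); exact: normr_Re.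
  have hb y : `|complex.Im (f y)| <= 1 by apply: le_trans (f1 y); exact: normr_Im.
  by have := sq4 _ x ha; have := sq4 _ x hb; lra.
have /orP[le|gt] : (U2_norm (f \- factor_avg (preim_partition c [set: G]) f) <= delta)
    || (delta < U2_norm (f \- factor_avg (preim_partition c [set: G]) f)).
  by rewrite leNgt orNb.
  (* Once the norm is small the map is kept, and its bounds are weakened to those for [k.+1]. *)
  exists T, c; split=> [||]; first by rewrite (leq_trans cT) // leq_pexp2l.
    by move=> t; apply: approximable_le (hc t) => M; exact: factor_growthS.
  by left.
case: hk => [le|hres]; first by have := lt_le_trans gt le; rewrite ltxx.
have [b [hb hdec]] := refine_step d0 f1 gt.
exists (T * bool)%type, (fun x => (c x, b x)); split.
- by rewrite card_prod card_bool expnSr leq_mul2r.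
- exact: refine_approximable.
- right; apply: le_trans hdec _; rewrite -[k.+1%:R]natr1 -/c0.
  move: (total_residual c f) ((c0 / 4) ^+ 2) hres => r eta hres; lra.
Qed.

End Iteration.

(** * Conclusion with uniform constants *)

Theorem proposition2p4 (R : realType) (delta : R)
    (hdelta : 0 < delta < 1 / 2) :
  exists (F : {posnum R} -> {posnum R}) (C : R),
    growth_function F /\
    forall (G : finZmodType) (f : G -> R[i]), bounded1 f ->
      exists B : {set {set G}},
        factor1 C F B /\ U2_norm (f \- factor_avg B f) <= delta.
Proof.
have /andP[d0 _] := hdelta.
pose eta := (delta ^+ 4 / 512 / 4) ^+ 2.
have c0 : 0 < delta ^+ 4 / 512.
  by apply: divr_gt0; [exact: exprn_gt0 | rewrite ltr0n].
have eta0 : 0 < eta by apply/exprn_gt0/divr_gt0; rewrite ?ltr0n.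
(* After this many decrements the residual would be negative, so the small-norm alternative holds;
   [k] depends on [delta] only. *)
have [k k8] : exists k, 8 < k%:R * eta.
  by exists (Num.truncn (8 / eta)).+1; rewrite -ltr_pdivrMr // truncnS_gt.
exists (posnum_growth (40 / (delta ^+ 4 / 512)) k), (2 ^ k)%N%:R; split.
  by move=> M N MN; rewrite -num_le /= factor_growth_homo.
move=> G f f1; have [T [c [cT hc hU]]] := iterate_refinement d0 f1 k.
exists (preim_partition c [set: G]); split.
  split; first exact: preim_partitionP.
    by rewrite ler_nat (leq_trans (preim_partition_card c)).
  by move=> E; apply: set_measurable1_preim hc _.
case: hU => // hres; have := residual_ge0 c (fun x => complex.Re (f x)).
have := residual_ge0 c (fun x => complex.Im (f x)).
have := natr_card_gt0 R G; move: hres; rewrite /total_residual -/eta.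
move: (residual _ _) (residual _ _) (#|G|%:R : R) => r1 r2 n hres n0 h1 h2.
have : (8 - k%:R * eta) * n < 0 by rewrite pmulr_llt0 // subr_lt0.
by lra.
Qed.
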